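(* Let $\mathcal G_{k,0}^{\mathrm{NS}},\mathcal G_{k+1,0}^{\mathrm{NS}}\subset Y_{\mathrm{prs}}$ be the selected pressure images at scales $k$ and $k+1$, let $P_{N,k}^{\mathrm{cl}},P_{N,k+1}^{\mathrm{cl}}:Y_{\mathrm{prs}}\to Y_{\mathrm{prs}}$ be finite-rank (bounded linear) projections, and let $T_k^{\mathrm{prs}}:Y_{\mathrm{prs}}\to Y_{\mathrm{prs}}$ be a bounded linear pressure-coordinate transport map. Let $\delta_k^{\mathrm{img}}\ge0$ be such that for every $g_{k+1}\in\mathcal G_{k+1,0}^{\mathrm{NS}}$ there exists $g_k\in\mathcal G_{k,0}^{\mathrm{NS}}$ with $\|g_{k+1}-T_k^{\mathrm{prs}}g_k\|_{Y_{\mathrm{prs}}}\le\delta_k^{\mathrm{img}}$, and set $$\omega_{k,N}^{\mathrm{proj}}:=\sup_{g\in\mathcal G_{k,0}^{\mathrm{NS}}}\bigl\|(I-P_{N,k+1}^{\mathrm{cl}})T_k^{\mathrm{prs}}g-T_k^{\mathrm{prs}}(I-P_{N,k}^{\mathrm{cl}})g\bigr\|_{Y_{\mathrm{prs}}},$$ $$C_{P,k+1}:=\|P_{N,k+1}^{\mathrm{cl}}\|_{Y_{\mathrm{prs}}\to Y_{\mathrm{prs}}},\qquad C_{T,k}:=\|T_k^{\mathrm{prs}}\|_{Y_{\mathrm{prs}}\to Y_{\mathrm{prs}}}.$$ Then $$\Delta_{k+1,\mathrm{proj},N}^{\mathrm{unif}}\le(1+C_{P,k+1})\delta_k^{\m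athrm{img}}+C_{T,k}\Delta_{k,\mathrm{proj},N}^{\mathrm{unif}}+\omega_{k,N}^{\mathrm{proj}}.$$
   Context: $Y_{\mathrm{prs}}=L^{3/2}((-1,0);L^{3/2}(B_{1/2}))$, $B_{1/2}\subset\mathbb R^3$. For each scale $m$, $\mathcal G_{m,0}^{\mathrm{NS}}$ is the set of images $R_iR_j(F_{ij})|_{B_{1/2}}$ (Riesz transforms, zero extension) of the selected clean sources $F$ of the scale-$m$ Navier--Stokes-generated package class (for the statement, a given subset of $Y_{\mathrm{prs}}$), and $\Delta_{m,\mathrm{proj},N}^{\mathrm{unif}}:=\sup_{g\in\mathcal G_{m,0}^{\mathrm{NS}}}\|(I-P_{N,m}^{\mathrm{cl}})g\|_{Y_{\mathrm{prs}}}$. *)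

(* Defs.v *)
From HB Require Import structures.
From mathcomp Require Import all_boot all_order all_algebra.
From mathcomp Require Import all_classical all_reals all_analysis.
From mathcomp Require Import measurable_realfun.

Set Implicit Arguments.
Unset Strict Implicit.
Unset Printing Implicit Defensive.
Import Order.TTheory GRing.Theory Num.Theory.
Import numFieldNormedType.Exports.
Local Open Scope classical_set_scope.
Local Open Scope ring_scope.

Record seminorm (R : numFieldType) (M : lmodType R) := Seminorm {
  seminorm_fun :> M -> R ;
  seminormD : forall x y, seminorm_fun (x + y) <= seminorm_fun x + seminorm_fun y ;
  seminormZ : forall (a : R) x, seminorm_fun (a *: x) = `|a| * seminorm_fun x
}.

Section SeparatedQuotient.
Context {R : numFieldType} {M : lmodType R} (n : seminorm M).
Local Open Scope quotient_scope.

Lemma seminorm0 : n 0 = 0.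
Proof. by rewrite -[X in n X](scale0r 0) seminormZ normr0 mul0r. Qed.

Lemma seminormN x : n (- x) = n x.
Proof. by rewrite -scaleN1r seminormZ normrN1 mul1r. Qed.

Lemma seminorm_ge0 x : 0 <= n x.
Proof.
have := seminormD n x (- x); rewrite subrr seminorm0 seminormN -mulr2n.
by rewrite pmulrn_lge0.
Qed.

Definition seminorm_null : {pred M} := [pred x : M | n x == 0].

Lemma seminorm_null_zmod_closed : zmod_closed seminorm_null.
Proof.
split=> [|x y]; first by rewrite !inE seminorm0.
rewrite !inE => /eqP x0 /eqP y0.
rewrite eq_le seminorm_ge0 andbT (le_trans (seminormD n _ _))//.
by rewrite seminormN x0 y0 addr0.
Qed.

HB.instance Definition _ :=
  GRing.isZmodClosed.Build M seminorm_null seminorm_null_zmod_closed.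

(* the quotient of M by the null space of n *)
Definition sepquot : Type := Quotient.quot seminorm_null.

HB.instance Definition _ := GRing.Zmodule.on sepquot.
HB.instance Definition _ := EqQuotient.on sepquot.

Definition sepquot_class (x : M) : sepquot := \pi_sepquot x.

Lemma sepquot_classE (q : sepquot) : exists x, q = sepquot_class x.
Proof. by exists (repr q); rewrite /sepquot_class reprK. Qed.

Lemma sepquot_eqP (x y : M) :
  sepquot_class x = sepquot_class y <-> n (x - y) = 0.
Proof.
have := Quotient.idealrBE seminorm_null x y; rewrite inE => e.
by split=> [xy|/eqP]; [apply/eqP; rewrite e; apply/eqP | rewrite e => /eqP].
Qed.

Lemma sepquot_classD x y :
  sepquot_class (x + y) = sepquot_class x + sepquot_class y.
Proof. exact: Quotient.pi_add. Qed.

Definition sepquot_scale (a : R) (q : sepquot) := sepquot_class (a *: repr q).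

Lemma sepquot_classZ a x :
  sepquot_class (a *: x) = sepquot_scale a (sepquot_class x).
Proof.
apply/sepquot_eqP; rewrite -scalerBr seminormZ.
suff -> : n (x - repr (sepquot_class x)) = 0 by rewrite mulr0.
by apply/sepquot_eqP; rewrite [RHS]reprK.
Qed.

Let scaleA a b q :
  sepquot_scale a (sepquot_scale b q) = sepquot_scale (a * b) q.
Proof.
have [x ->] := sepquot_classE q.
by rewrite -!sepquot_classZ scalerA.
Qed.

Let scale1 : left_id 1 sepquot_scale.
Proof.
by move=> q; have [x ->] := sepquot_classE q; rewrite -sepquot_classZ scale1r.
Qed.

Let scaleDr : right_distributive sepquot_scale +%R.
Proof.
move=> a p q; have [x ->] := sepquot_classE p; have [y ->] := sepquot_classE q.
by rewrite -sepquot_classD -!sepquot_classZ -sepquot_classD scalerDr.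
Qed.

Let scaleDl q : {morph sepquot_scale^~ q : a b / a + b}.
Proof.
move=> a b /=; have [x ->] := sepquot_classE q.
by rewrite -!sepquot_classZ -sepquot_classD scalerDl.
Qed.

HB.instance Definition _ :=
  GRing.Zmodule_isLmodule.Build R sepquot scaleA scale1 scaleDr scaleDl.

Definition sepquot_norm (q : sepquot) : R := n (repr q).

Lemma sepquot_norm_class x : sepquot_norm (sepquot_class x) = n x.
Proof.
have := (sepquot_eqP (repr (sepquot_class x)) x).1 (reprK _) => e.
rewrite /sepquot_norm; apply/eqP; rewrite eq_le; apply/andP; split.
- by rewrite -[X in n X <= _](subrK x) (le_trans (seminormD _ _ _))// e add0r.
- set z := repr _ in e *; rewrite -[X in n X <= _](subrK z).
  by rewrite (le_trans (seminormD _ _ _))// -opprB seminormN e add0r.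
Qed.

Let norm_triangle p q : sepquot_norm (p + q) <= sepquot_norm p + sepquot_norm q.
Proof.
have [x ->] := sepquot_classE p; have [y ->] := sepquot_classE q.
by rewrite -sepquot_classD !sepquot_norm_class seminormD.
Qed.

Let norm_scale (a : R) q : sepquot_norm (a *: q) = `|a| * sepquot_norm q.
Proof.
have [x ->] := sepquot_classE q.
by rewrite -[_ *: _]sepquot_classZ !sepquot_norm_class seminormZ.
Qed.

Let norm_eq0 q : sepquot_norm q = 0 -> q = 0.
Proof.
have [x ->] := sepquot_classE q; rewrite sepquot_norm_class => x0.
have -> : (0 : sepquot) = sepquot_class 0.
  by apply: (addrI (sepquot_class 0)); rewrite -sepquot_classD !addr0.
by apply/sepquot_eqP; rewrite subr0.
Qed.

HB.instance Definition _ :=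
  Lmodule_isNormed.Build R sepquot norm_triangle norm_scale norm_eq0.

Lemma norm_sepquot_class x : `|sepquot_class x| = n x.
Proof. exact: sepquot_norm_class. Qed.

End SeparatedQuotient.


Section LnormAux.
Context d (T : measurableType d) (R : realType).
Variables (mu : {measure set T -> \bar R}) (p : R) (p1 : (1 <= p%:E)%E).
Implicit Types u v : T -> R.

Let p0 : 0 < p. Proof. by rewrite (lt_le_trans ltr01)// -lee_fin. Qed.

Let mpow u : measurable_fun setT u ->
  measurable_fun setT ((fun x => `|(u x)%:E| `^ p)%E : T -> \bar R).
Proof.
move=> mu_; under eq_fun do rewrite abse_EFin poweR_EFin.
by apply/measurable_EFinP/(@measurableT_comp _ _ _ _ _ _ (@powR R ^~ p)) => //;
  exact: measurableT_comp.
Qed.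

Lemma le_Lnorm u v : measurable_fun setT u -> measurable_fun setT v ->
  (forall x, `|u x| <= `|v x|) ->
  ('N[mu]_p%:E[EFin \o u] <= 'N[mu]_p%:E[EFin \o v])%E.
Proof.
move=> mu_ mv uv; rewrite unlock /=.
have I0 w : (\int[mu]_x (`|(w x)%:E| `^ p))%E \in `[0%E, +oo%E].
  by rewrite in_itv/= leey andbT integral_ge0// => x _; exact: poweR_ge0.
apply: gt0_ler_poweR (I0 u) (I0 v) _; first by rewrite invr_ge0 ltW.
apply: (@ge0_le_integral _ _ _ mu setT measurableT) => [x _|||];
  [exact: poweR_ge0|exact: (mpow mu_)|exact: (mpow mv)|].
move=> x _; apply: gt0_ler_poweR; rewrite ?(ltW p0)// ?in_itv/= ?leey ?andbT//.
exact: uv.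
Qed.

Lemma ae_eq0_Lnorm u : measurable_fun setT u ->
  u = cst 0 %[ae mu] -> ('N[mu]_p%:E[EFin \o u] = 0)%E.
Proof.
move=> mu_ u0; rewrite unlock /=.
have -> : (\int[mu]_x (`|(u x)%:E| `^ p) = \int[mu]_(x in setT) cst 0 x)%E.
  apply: ge0_ae_eq_integral => [//||//|x _|//|].
  - exact: (mpow mu_).
  - exact: poweR_ge0.
  - apply: filterS u0 => x /(_ I) /= ux _.
    by rewrite ux normr0 powR0// gt_eqF.
by rewrite integral0 poweR0r// invr_eq0 gt_eqF.
Qed.

End LnormAux.

(* [Lp mu p1] is the space of the library functions [LfunType mu p1] modulo
   almost everywhere equality (see [Lp_eqP]), with norm ['N[mu]_p] (see
   [Lp_normE]); the library type [LspaceType] carries no normed structure. *)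

Section Lp.
Context d (T : measurableType d) (R : realType).
Variables (mu : {measure set T -> \bar R}) (p : R) (p1 : (1 <= p%:E)%E).

Let nm (f : LfunType mu p1) : R := fine ('N[mu]_p%:E[EFin \o f])%E.

Let nmZ (a : R) f : nm (a *: f) = `|a| * nm f.
Proof.
by apply/EFin_inj; rewrite EFinM !finite_norm_fine [LHS]LnormZ.
Qed.

Definition Lp_seminorm : seminorm (LfunType mu p1) :=
  Seminorm (@ler_LnormD _ _ _ mu p%:E p1) nmZ.

Definition Lp : normedModType R := sepquot Lp_seminorm.

Definition Lp_class (f : LfunType mu p1) : Lp := sepquot_class Lp_seminorm f.

Lemma Lp_normE (f : LfunType mu p1) :
  `|Lp_class f|%:E = ('N[mu]_p%:E[EFin \o f])%E.
Proof. by rewrite norm_sepquot_class finite_norm_fine. Qed.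

Lemma Lp_eqP (f g : LfunType mu p1) :
  Lp_class f = Lp_class g <-> f = g %[ae mu].
Proof.
split=> [/sepquot_eqP/fine_Lnormr_eq0|fg].
  by apply: filterS => x /(_ I) /= /eqP; rewrite subr_eq0 => /eqP.
apply/sepquot_eqP; apply/EFin_inj; rewrite [LHS]finite_norm_fine.
apply: ae_eq0_Lnorm => //; apply: filterS fg => x /(_ I) /= fg _.
by apply/eqP; rewrite subr_eq0; apply/eqP.
Qed.

End Lp.

Section StronglyMeasurable.
Context d (T : measurableType d) (R : realType) (X : normedModType R).

Definition simple_map (s : T -> X) :=
  finite_set (range s) /\ forall x, measurable (s @^-1` [set x]).

(* The limit is taken at every point: modulo almost everywhere equality this
   gives the same classes as almost everywhere limits of simple functions, and
   it makes the norm of f measurable without completing the measure. *)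
Definition strongly_measurable (f : T -> X) :=
  exists s : nat -> T -> X,
    (forall n, simple_map (s n)) /\ forall t, s n t @[n --> \oo] --> f t.

Lemma simple_map_preimage s (A : set X) :
  simple_map s -> measurable (s @^-1` A).
Proof.
move=> [fs ms].
have -> : s @^-1` A = \bigcup_(x in range s `&` A) s @^-1` [set x].
  apply/seteqP; split=> [t At|t [x [_ Ax]] /= ->//].
  by exists (s t) => //; split => //; exists t.
by apply: fin_bigcup_measurable => //; exact: finite_setIl.
Qed.

Lemma simple_map_comp2 (h : X -> X -> X) s s' :
  simple_map s -> simple_map s' -> simple_map (fun t => h (s t) (s' t)).
Proof.
move=> ss ss'; split.
  apply: (@sub_finite_set _ _
    ((fun q => h q.1 q.2) @` (range s `*` range s'))); last first.
    by apply/finite_image/finite_setX; [exact: ss.1|exact: ss'.1].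
  by move=> _ [t _ <-]; exists (s t, s' t) => //=; split; exists t.
move=> x.
rewrite (_ : _ @^-1` _ = \bigcup_(y in range s)
    (s @^-1` [set y] `&` s' @^-1` [set z | h y z = x])).
  apply: fin_bigcup_measurable => [|y _]; first exact: ss.1.
  by apply: measurableI; exact: simple_map_preimage.
apply/seteqP; split=> [t /= tx|t [y _ [/= ->]]//].
by exists (s t) => //; exists t.
Qed.

Lemma simple_map_cst (x : X) : simple_map (fun=> x).
Proof.
split; last by move=> y; rewrite preimage_cst; case: ifP.
by apply: (sub_finite_set _ (finite_set1 x)) => _ [t _ <-].
Qed.

Lemma simple_map_norm s : simple_map s -> measurable_fun setT (fun t => `|s t|).
Proof.
move=> ss _ A mA; rewrite setTI.
exact: (@simple_map_preimage s [set x | A `|x|]).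
Qed.

Lemma strongly_measurable0 : strongly_measurable 0.
Proof.
exists (fun _ _ => 0); split=> [_|t]; first exact: simple_map_cst.
exact: cvg_cst.
Qed.

Lemma strongly_measurableD f g : strongly_measurable f ->
  strongly_measurable g -> strongly_measurable (f + g).
Proof.
move=> [s [ss sf]] [s' [ss' sg]]; exists (fun n t => s n t + s' n t).
split=> [n|t]; first exact: (simple_map_comp2 +%R).
by apply: cvgD; [exact: sf|exact: sg].
Qed.

Lemma strongly_measurableZ a f :
  strongly_measurable f -> strongly_measurable (a *: f).
Proof.
move=> [s [ss sf]]; exists (fun n t => a *: s n t).
split=> [n|t]; first exact: (simple_map_comp2 (fun x _ => a *: x) (ss n) (ss n)).
by apply: cvgZr; exact: sf.
Qed.

Lemma strongly_measurable_norm f :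
  strongly_measurable f -> measurable_fun setT (fun t => `|f t|).
Proof.
move=> [s [ss sf]].
apply: (@measurable_fun_cvg _ _ _ _ (fun n t => `|s n t|)).
- by move=> n; exact: simple_map_norm.
- by move=> t _; apply: cvg_norm; exact: sf.
Qed.

End StronglyMeasurable.

Section Bochner.
Context d (T : measurableType d) (R : realType).
Variables (mu : {measure set T -> \bar R}) (p : R) (p1 : (1 <= p%:E)%E).
Variable X : normedModType R.
Implicit Types f g : T -> X.

Definition Bochner_Lnorm (f : T -> X) : \bar R :=
  ('N[mu]_p%:E[(fun t => `|f t|%:E)])%E.

(* p1 is an argument only for the benefit of the inference of instances *)
Definition bochner_pred of (1 <= p%:E)%E : {pred T -> X} :=
  mem [set f | strongly_measurable f /\ (Bochner_Lnorm f < +oo)%E].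

Lemma Bochner_LnormD f g : strongly_measurable f -> strongly_measurable g ->
  (Bochner_Lnorm (f + g)%R <= Bochner_Lnorm f + Bochner_Lnorm g)%E.
Proof.
move=> sf sg.
have mf := strongly_measurable_norm sf; have mg := strongly_measurable_norm sg.
have mfg := strongly_measurable_norm (strongly_measurableD sf sg).
apply: le_trans (eminkowski mu mf mg p1).
apply: (@le_Lnorm _ _ _ mu p p1 (fun t => `|(f + g) t|)) => //.
  exact: measurable_funD.
by move=> t /=; rewrite normr_id ger0_norm ?ler_normD// addr_ge0.
Qed.

Lemma Bochner_LnormZ a f :
  Bochner_Lnorm f \is a fin_num -> strongly_measurable f ->
  Bochner_Lnorm (a *: f)%R = (`|a|%:E * Bochner_Lnorm f)%E.
Proof.
move=> ff sf.
have mf := strongly_measurable_norm sf.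
have Lf : (fun t => `|f t|) \in Lfun mu p%:E.
  rewrite inE; apply/andP; split; first by rewrite inE.
  by rewrite inE/= /finite_norm (_ : _ < +oo)%E// ltey_eq ff.
have := LnormZ (Lfun_Sub p1 Lf) `|a|.
rewrite normr_id => <-; congr Lnorm; apply/funext => t /=.
by rewrite normrZ.
Qed.

Lemma Bochner_Lnorm_ge0 f : (0 <= Bochner_Lnorm f)%E.
Proof. exact: Lnorm_ge0. Qed.

Lemma bochner_submod_closed : submod_closed (bochner_pred p1).
Proof.
split=> [|a f g]; rewrite !inE /=.
  split; first exact: strongly_measurable0.
  rewrite /Bochner_Lnorm (@eq_Lnorm _ _ _ mu p%:E _ (cst 0%E)).
    by rewrite Lnorm0// gt_eqF// (lt_le_trans _ p1).
  by move=> t /=; rewrite normr0.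
move=> [sf foo] [sg goo].
split; first by apply: strongly_measurableD => //; exact: strongly_measurableZ.
apply: (le_lt_trans (Bochner_LnormD (strongly_measurableZ a sf) sg)).
rewrite Bochner_LnormZ//; last by rewrite ge0_fin_numE// Bochner_Lnorm_ge0.
by rewrite lte_add_pinfty// lte_mul_pinfty.
Qed.

HB.instance Definition _ :=
  GRing.isSubmodClosed.Build R (T -> X) (bochner_pred p1) bochner_submod_closed.

(* As for [Lp], classes are identified by almost everywhere equality and the
   norm is [(\int[mu]_t `|f t| `^ p) `^ p^-1]: see [Bochner_eqP] and
   [Bochner_normE]. *)
Record BochnerFun := MkBochnerFun {
  bochner_fun :> T -> X ;
  bochner_funP : bochner_fun \in bochner_pred p1
}.

HB.instance Definition _ := [isSub for bochner_fun].
HB.instance Definition _ := gen_eqMixin BochnerFun.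
HB.instance Definition _ := gen_choiceMixin BochnerFun.
HB.instance Definition _ := [SubChoice_isSubLmodule of BochnerFun by <:].

Lemma bochner_fun_strongly_measurable (f : BochnerFun) : strongly_measurable f.
Proof. by have := bochner_funP f; rewrite inE => -[]. Qed.

Lemma bochner_fun_fin_num (f : BochnerFun) : Bochner_Lnorm f \is a fin_num.
Proof.
have := bochner_funP f; rewrite inE => -[_ foo].
by rewrite ge0_fin_numE// Bochner_Lnorm_ge0.
Qed.

Let nm (f : BochnerFun) : R := fine (Bochner_Lnorm f).

Let nmD (f g : BochnerFun) : nm (f + g) <= nm f + nm g.
Proof.
rewrite -lee_fin EFinD !fineK ?bochner_fun_fin_num//.
by apply: Bochner_LnormD; exact: bochner_fun_strongly_measurable.
Qed.

Let nmZ (a : R) (f : BochnerFun) : nm (a *: f) = `|a| * nm f.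
Proof.
apply/EFin_inj; rewrite EFinM !fineK ?bochner_fun_fin_num//.
apply: Bochner_LnormZ; first exact: bochner_fun_fin_num.
exact: bochner_fun_strongly_measurable.
Qed.

Definition Bochner_seminorm : seminorm BochnerFun := Seminorm nmD nmZ.

Definition Bochner : normedModType R := sepquot Bochner_seminorm.

Definition Bochner_class (f : BochnerFun) : Bochner :=
  sepquot_class Bochner_seminorm f.

Lemma Bochner_normE (f : BochnerFun) : `|Bochner_class f|%:E = Bochner_Lnorm f.
Proof. by rewrite norm_sepquot_class fineK// bochner_fun_fin_num. Qed.

Lemma Bochner_eqP (f g : BochnerFun) :
  Bochner_class f = Bochner_class g <-> f = g %[ae mu].
Proof.
have mfg := strongly_measurable_norm (bochner_fun_strongly_measurable (f - g)).
have p0 : (0 < p%:E)%E by rewrite (lt_le_trans lte01 p1).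
split=> [/sepquot_eqP fg0|fg].
  have : Bochner_Lnorm (f - g) = 0%E.
    by rewrite -(fineK (bochner_fun_fin_num (f - g))); congr EFin.
  move=> /Lnorm_eq0_eq0; have /measurable_EFinP := mfg.
  move=> /[swap] /[apply] /(_ p0); apply: filterS => x /(_ I) /= [] /eqP.
  by rewrite normr_eq0 subr_eq0 => /eqP.
apply/sepquot_eqP; apply/EFin_inj; rewrite [LHS]fineK ?bochner_fun_fin_num//.
apply: (@ae_eq0_Lnorm _ _ _ mu p p1 (fun t => `|(f - g) t|)) => //.
apply: filterS fg => x /(_ I) /= fg _.
by apply/eqP; rewrite normr_eq0 subr_eq0; apply/eqP.
Qed.

End Bochner.

Section PressureSpace.
Context (R : realType).

Lemma three_halves_ge1 : (1 <= (3 / 2 : R)%:E)%E.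
Proof. by rewrite lee_fin ler_pdivlMr// mul1r ler_nat. Qed.

Local Notation mR := (measurableTypeR R).

Definition lebesgue3 : {measure set (mR * mR * mR) -> \bar R} :=
  ((@lebesgue_measure R \x @lebesgue_measure R) \x @lebesgue_measure R)%E.

(* the Euclidean ball: the norm of the product type R * R * R is the sup norm *)
Definition ball_half : set (mR * mR * mR) :=
  [set x | x.1.1 ^+ 2 + x.1.2 ^+ 2 + x.2 ^+ 2 < (1 / 2) ^+ 2].

Lemma measurable_ball_half : measurable ball_half.
Proof.
rewrite -[X in measurable X]setTI.
have mf : measurable_fun setT
    (fun x : mR * mR * mR => x.1.1 ^+ 2 + x.1.2 ^+ 2 + x.2 ^+ 2).
  apply: measurable_funD; first apply: measurable_funD.
  - by apply: measurable_funX; apply: measurableT_comp.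
  - by apply: measurable_funX; apply: measurableT_comp.
  - by apply: measurable_funX.
rewrite (_ : ball_half = (fun x : mR * mR * mR =>
  x.1.1 ^+ 2 + x.1.2 ^+ 2 + x.2 ^+ 2) @^-1` `]-oo, ((1 / 2) ^+ 2)[).
  exact: mf.
by apply/seteqP; split=> x /=; rewrite in_itv.
Qed.

Lemma measurable_time : measurable (`](-1 : R), 0[%classic : set mR).
Proof. exact: measurable_itv. Qed.

(* Functions on B_{1/2} and on (-1, 0) are represented by functions on the whole
   space, for the restriction of the Lebesgue measure: values outside the domain
   are irrelevant modulo almost everywhere equality. *)
Definition mu_ball : {measure set (mR * mR * mR) -> \bar R} :=
  mrestr lebesgue3 measurable_ball_half.

Definition mu_time : {measure set mR -> \bar R} :=
  mrestr (@lebesgue_measure R) measurable_time.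

Definition L32_ball : normedModType R := Lp mu_ball three_halves_ge1.

Definition Yprs : normedModType R := Bochner mu_time three_halves_ge1 L32_ball.

End PressureSpace.

Section Operators.
Context (R : realType) (Y : normedModType R).
Implicit Types (f : Y -> Y) (P : {linear Y -> Y}).

Definition bounded_op f := exists C : R, forall x, `|f x| <= C * `|x|.

(* meaningful for bounded operators only: otherwise the value is 0 *)
Definition opnorm f : R := sup [set `|f x| | x in [set x | `|x| <= 1]].

Definition finite_rank f := exists n (e : 'I_n -> Y),
  forall x, exists c : 'I_n -> R, f x = \sum_i c i *: e i.

Definition finite_rank_projection P :=
  [/\ bounded_op P, finite_rank P & forall x, P (P x) = P x].

(* The suprema are extended real numbers, since no boundedness of G is assumed. *)
Definition Delta_proj (G : set Y) P : \bar R :=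
  ereal_sup [set `|g - P g|%:E | g in G].

Definition omega_proj (G : set Y) (P P' T : {linear Y -> Y}) : \bar R :=
  ereal_sup [set `|(T g - P' (T g)) - T (g - P g)|%:E | g in G].

End Operators.

(* Main.v *)
Require Import Defs.
From mathcomp Require Import all_boot all_order all_algebra.
From mathcomp Require Import all_classical all_reals all_analysis.
Import Order.TTheory GRing.Theory Num.Theory.
Import numFieldNormedType.Exports.
Local Open Scope classical_set_scope.
Local Open Scope ring_scope.

(** Each [g1] at scale [k.+1] is within [delta k] of some [T k g] with [g] at scale [k]. Adding and
    subtracting [T k g] splits the defect of [g1] into three pieces: the defect of [g1 - T k g],
    controlled by [opnorm_bound] for [P N k.+1]; the transported defect of [g], controlled by
    [opnorm_bound] for [T k]; and a commutator bounded by the supremum [omega_proj]. The resulting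
    bound is uniform in [g1], so it passes to the supremum. *)

Lemma opnorm_bound {R : realType} {Y : normedModType R} (f : {linear Y -> Y})
  (x : Y) : bounded_op f -> `|f x| <= opnorm f * `|x|.
Proof.
move=> [C fC]; have [->|x0] := eqVneq x 0.
  by rewrite linear0 !normr0 mulr0.
have nx0 : 0 < `|x| by rewrite normr_gt0.
rewrite -ler_pdivrMr//.
have -> : `|f x| / `|x| = `|f (`|x|^-1 *: x)|.
  by rewrite linearZ normrZ normfV normr_id mulrC.
apply: ub_le_sup; last first.
  by exists (`|x|^-1 *: x) => //=; rewrite normrZ normfV normr_id mulVf ?gt_eqF.
(* The constant [C] may be negative when [Y] is trivial; [|C|] bounds the values on the whole unit
   ball. *)
exists `|C| => _ [y /= y1 <-]; apply: (le_trans (fC y)).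
apply: (le_trans (ler_wpM2r _ (ler_norm C))) => //.
by rewrite ler_piMr.
Qed.

Lemma opnorm_ge0 {R : realType} {Y : normedModType R} (f : Y -> Y) :
  0 <= opnorm f.
Proof.
rewrite /opnorm; set E := (X in sup X).
(* Without a supremum, [sup] takes its default value 0; otherwise it dominates the value [|f 0|]. *)
have [[_ ubE]|/sup_out ->//] := pselect (has_sup E).
apply: (@le_trans _ _ `|f 0|) => //.
by apply: ub_le_sup => //; exists 0; rewrite //= normr0.
Qed.

Theorem theorem12p7 (R : realType) (k N : nat)
    (G : nat -> set (Yprs R))
    (P : nat -> nat -> {linear Yprs R -> Yprs R})
    (T : nat -> {linear Yprs R -> Yprs R})
    (delta : nat -> R)
    (hPk : finite_rank_projection (P N k))
    (hPk1 : finite_rank_projection (P N k.+1))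
    (hT : bounded_op (T k))
    (hdelta0 : 0 <= delta k)
    (hdelta : forall g1, G k.+1 g1 ->
      exists2 g, G k g & `|g1 - T k g| <= delta k) :
  (Delta_proj (G k.+1) (P N k.+1) <=
     ((1 + opnorm (P N k.+1)) * delta k)%:E
     + (opnorm (T k))%:E * Delta_proj (G k) (P N k)
     + omega_proj (G k) (P N k) (P N k.+1) (T k))%E.
Proof.
case: hPk1 => bP' _ _.
apply: ge_ereal_sup => _ [g1 Gg1 <-].
have [g Gg g1g] := hdelta g1 Gg1.
set P' := P N k.+1; set h := g - P N k g; set r := g1 - T k g.
set w := (T k g - P' (T k g)) - T k h.
(* The defect at g1 splits into the transport error r, the transported defect
   T h, and the commutator w. *)
have -> : g1 - P' g1 = (r - P' r) + T k h + w.
  (* [T k h] cancels against [w]; linearity of [P'] then reassembles [r] and [T k g] into [g1]. *)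
  by rewrite -addrA [T k h + _]addrC subrK linearB addrACA -opprD !subrK.
have r_le : `|r - P' r| <= (1 + opnorm P') * delta k.
  apply: (le_trans (ler_normB _ _)); rewrite mulrDl mul1r.
  apply: lerD => //; apply: (le_trans (opnorm_bound P' r bP')).
  by rewrite ler_wpM2l// opnorm_ge0.
apply: (@le_trans _ _ (`|r - P' r|%:E + `|T k h|%:E + `|w|%:E)%E).
  by rewrite -!EFinD lee_fin (le_trans (ler_normD _ _))// lerD2r ler_normD.
apply: leeD; first apply: leeD.
- by rewrite lee_fin.
- apply: (@le_trans _ _ ((opnorm (T k))%:E * `|h|%:E)%E).
    by rewrite -EFinM lee_fin opnorm_bound.
  (* The comparison is in the extended reals, as [Delta_proj] may be infinite. *)
  apply: lee_wpmul2l; first by rewrite lee_fin opnorm_ge0.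
  by apply: ereal_sup_ubound; exists g.
- by apply: ereal_sup_ubound; exists g.
Qed.
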